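(* Let $d\ge4$ be an even integer. For $(p,q)\in\mathbb{R}^2$ let $$\mathcal{L}_{p,q}(Z)=(1-p-q)\frac{\operatorname{Tr}(Z)}dI_d+pZ+q\,\Omega_dZ^\top\Omega_d^*,\qquad Z\in M_d(\mathbb{C}),$$ and let $\mathbb{P}_k^{(d)}$ (for $1\le k\le d$) and $\mathbb{D}^{(d)}$ be the sets of $(p,q)\in\mathbb{R}^2$ such that $\mathcal{L}_{p,q}$ is $k$-positive, respectively decomposable. Consider the linear map $$\mathcal{L}_{p,q}^\top:=\top\circ\mathcal{L}_{p,q}:Z\mapsto(1-p-q)\frac{\operatorname{Tr}(Z)}dI_d+pZ^\top+q\,\Omega_dZ\Omega_d^*.$$ Then: (1) $\mathcal{L}_{p,q}^\top$ is $k$-positive ($1\le k\le d$) if and only if $(q,p)\in\mathbb{P}_k^{(d)}$; (2) $\mathcal{L}_{p,q}^\top$ is decomposable if and only if $(q,p)\in\mathbb{D}^{(d)}$ (if and only if $(p,q)\in\mathbb{D}^{(d)}$). In particular, there exist $(\frac d2-1)$-positive indecomposable $(S,\overline S)$-covariant linear maps on $M_d(\mathbb{C})$, while every $\frac d2$-positive $(S,\overline S)$-covariant linear map is decomposable.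
   Context: $\Omega_d=\begin{pmatrix}0&I_{d/2}\\-I_{d/2}&0\end{pmatrix}$, $Sp(d)=\{S\in U(d):S^\top\Omega_dS=\Omega_d\}$, $\top(Z)=Z^\top$. A linear map $\mathcal{L}$ on $M_d(\mathbb{C})$ is $(S,\overline S)$-covariant if $\mathcal{L}(SZS^* )=\overline S\mathcal{L}(Z)\overline S^*$ for all $S\in Sp(d)$, $Z\in M_d(\mathbb{C})$ ($\overline S$ = entrywise complex conjugate). $\mathcal{L}$ is $k$-positive if $\mathrm{id}_k\otimes\mathcal{L}$ maps positive semidefinite matrices to positive semidefinite matrices; completely positive (CP) if $k$-positive for all $k$; completely copositive (co-CP) if $\top\circ\mathcal{L}$ is CP; decomposable if it is the sum of a CP and a co-CP map, indecomposable otherwise. *)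

(* Defs.v *)
From HB Require Import structures.
From mathcomp Require Import all_boot all_order all_algebra.
From mathcomp Require Import classical_sets reals.
From mathcomp Require Import complex.
From mathcomp Require Import ring.
From mathcomp Require mxtens.

Set Implicit Arguments.
Unset Strict Implicit.
Unset Printing Implicit Defensive.

Import Order.TTheory GRing.Theory Num.Theory.
Local Open Scope ring_scope.
Local Open Scope complex_scope.
Local Open Scope sesquilinear_scope.

Notation entry_conj A := (map_mx Num.conj A).

Section Positivity.
Variable R : realType.
Local Notation C := R[i].

(* The order of [R[i]] makes [0 <= z] imply that [z] is real. *)
Definition psd n (A : 'M[C]_n) : Prop :=
  forall v : 'cV[C]_n, 0 <= (v^t* *m A *m v) 0 0.

(* 'M_k (x) 'M_d is identified with 'M_(k * d) through the Kronecker product;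
   [tens_block a b X] is the coefficient X_ab in 'M_d of
   X = \sum_(a, b) E_ab (x) X_ab. *)
Definition tens_block k d (a b : 'I_k) (X : 'M[C]_(k * d)) : 'M[C]_d :=
  \matrix_(i, j) X (mxtens.mxtens_index (a, i)) (mxtens.mxtens_index (b, j)).

Definition id_tens k d (L : {linear 'M[C]_d -> 'M[C]_d}) (X : 'M[C]_(k * d)) :
    'M[C]_(k * d) :=
  \sum_a \sum_b mxtens.tensmx (delta_mx a b) (L (tens_block a b X)).

Lemma id_tens_tensmx k d (L : {linear 'M[C]_d -> 'M[C]_d})
    (A : 'M[C]_k) (B : 'M[C]_d) :
  id_tens L (mxtens.tensmx A B) = mxtens.tensmx A (L B).
Proof.
apply/matrixP => s t.
case: (mxtens.mxtens_indexP s) => a i; case: (mxtens.mxtens_indexP t) => b j.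
rewrite mxtens.tensmxE /id_tens summxE (bigD1 a) //= summxE (bigD1 b) //=.
rewrite [X in _ + X + _]big1 => [|b' nb]; last first.
  by rewrite mxtens.tensmxE mxE eqxx /= eq_sym (negPf nb) mul0r.
rewrite [X in _ + X]big1 => [|a' na]; last first.
  rewrite summxE big1 // => b' _.
  by rewrite mxtens.tensmxE mxE eq_sym (negPf na) mul0r.
rewrite mxtens.tensmxE mxE !eqxx mul1r !addr0.
suff -> : tens_block a b (mxtens.tensmx A B) = A a b *: B.
  by rewrite linearZ mxE.
by apply/matrixP => x y; rewrite !mxE !mxtens.mxtens_indexK.
Qed.

Definition k_positive k d (L : {linear 'M[C]_d -> 'M[C]_d}) : Prop :=
  forall X : 'M[C]_(k * d), psd X -> psd (id_tens L X).

Definition completely_positive d (L : {linear 'M[C]_d -> 'M[C]_d}) : Prop :=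
  forall k, k_positive k L.

Definition completely_copositive d (L : {linear 'M[C]_d -> 'M[C]_d}) : Prop :=
  completely_positive (trmx \o L).

Definition decomposable d (L : {linear 'M[C]_d -> 'M[C]_d}) : Prop :=
  exists L1 L2 : {linear 'M[C]_d -> 'M[C]_d},
    [/\ completely_positive L1, completely_copositive L2
      & forall Z, L Z = L1 Z + L2 Z].

Definition indecomposable d (L : {linear 'M[C]_d -> 'M[C]_d}) : Prop :=
  ~ decomposable L.

End Positivity.

Section Symplectic.
Variable R : realType.
Local Notation C := R[i].

(* Given entrywise so that it lives in 'M_d; meaningful for even [d] only
   (see [Omega_block]). *)
Definition Omega d : 'M[C]_d :=
  \matrix_(i, j) ((j == i + d./2 :> nat)%N%:R - (i == j + d./2 :> nat)%N%:R).

Lemma Omega_block m : Omega (m + m) = block_mx 0 1%:M (- 1%:M) 0.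
Proof.
have lt_eqF (a b : 'I_m) : (a == b + m + m :> nat)%N = false.
  by apply/ltn_eqF/(leq_trans (ltn_ord a)); rewrite -addnA addnCA leq_addr.
have lt_eqF0 (a b : 'I_m) : (a == b + m :> nat)%N = false.
  by apply/ltn_eqF/(leq_trans (ltn_ord a)); rewrite leq_addl.
have half : ((m + m)./2 = m)%N by rewrite addnn doubleK.
apply/matrixP => i j; rewrite !mxE half.
case: split_ordP => a ->; rewrite !mxE;
  case: split_ordP => b ->; rewrite !mxE /= ?(addnC m).
- by rewrite !lt_eqF0 subrr.
- by rewrite eqn_add2r lt_eqF subr0 eq_sym.
- by rewrite eqn_add2r lt_eqF sub0r.
- by rewrite !eqn_add2r !lt_eqF0 subrr.
Qed.

Definition Sp d : set 'M[C]_d :=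
  [set S | S \is unitarymx /\ S^T *m Omega d *m S = Omega d].

Definition conj_covariant d (L : {linear 'M[C]_d -> 'M[C]_d}) : Prop :=
  forall S Z : 'M[C]_d, Sp S ->
    L (S *m Z *m S^t*) = entry_conj S *m L Z *m (entry_conj S)^t*.

Section Family.
Variables (d : nat) (p q : R).

Definition Lpq (Z : 'M[C]_d) : 'M[C]_d :=
  ((1 - p - q)%:C * (\tr Z / d%:R)) *: 1%:M
  + p%:C *: Z
  + q%:C *: (Omega d *m Z^T *m (Omega d)^t*).

Lemma Lpq_is_linear : linear Lpq.
Proof.
move=> a Y Z; rewrite /Lpq !linearP /= !linearD /= mulmxDl -scalemxAl.
move: (_ *m _ *m _) (_ *m _ *m _) => U V.
apply/matrixP => i j; rewrite !mxE.
ring.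
Qed.

HB.instance Definition _ :=
  GRing.isLinear.Build C 'M[C]_d 'M[C]_d _ Lpq Lpq_is_linear.

Definition LpqT : {linear 'M[C]_d -> 'M[C]_d} := trmx \o Lpq.

End Family.

Definition kpos_set k d : set (R * R) :=
  [set x | k_positive k (Lpq (d := d) x.1 x.2)].

Definition decomp_set d : set (R * R) :=
  [set x | decomposable (Lpq (d := d) x.1 x.2)].

End Symplectic.

Arguments LpqT {R} d p q.
Arguments kpos_set {R} k d.
Arguments decomp_set {R} d.
Arguments Omega {R} d.

(* Main.v *)
(* With Om = Omega d, write Psi a p q Z = a Tr(Z) + p Z^T + q Om Z Om^*.
   Conjugation by Om turns L^T_(p,q) into L_(q,p), and transposition exchanges
   CP and co-CP maps; this gives (1) and (2).

   k-positivity of L says that sum_(a,b) w_a^* L(x_a x_b^* ) w_b >= 0 for all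
   vectors x_1, w_1, ..., x_k, w_k. For Psi a p q this form is
   a |A|^2 + p Tr(A conj A) + q |Tr(Om A)|^2 with A = sum_a x_a w_a^* of rank at
   most k. Since A - A^T has rank at most min(2k, d), the inequality
   |Tr M|^2 <= rank M |M|^2 shows that Psi 1 (-1) (-1/k) is k-positive, and is
   CP if k = d/2. For k = d/2 - 1 it is indecomposable: pairing the Choi matrix
   with a PPT operator gives a functional that is nonnegative on CP and co-CP
   maps and equals d^2 ((1 + 2/d) a + p + q) on Psi a p q.

   A covariant map L is some Psi a p q: the stabilizer of the line of e_1 forces
   L(e_1 e_1^* ) to be diagonal with only three different entries, and
   quaternionic reflections carry e_1 to enough vectors to determine L
   everywhere. Positivity of these entries gives a >= 0 and a + p >= 0; testing
   d/2-positivity on an isotropic subspace gives a + q d/2 >= 0. Then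
   Psi a (-a) q is CP and Psi 0 (a + p) 0 is co-CP. *)

From HB Require Import structures.
Require Import Defs.
From mathcomp Require Import all_boot all_order all_algebra.
From mathcomp Require Import classical_sets reals complex.
From mathcomp Require Import ring.
From mathcomp Require mxtens.

Set Implicit Arguments.
Unset Strict Implicit.
Unset Printing Implicit Defensive.

Import Order.TTheory GRing.Theory Num.Theory.
Local Open Scope ring_scope.
Local Open Scope sesquilinear_scope.

(** * Hermitian forms *)

Section ClosedField.
Variable C : numClosedFieldType.

Lemma quad_formE n (A : 'M[C]_n) (u v : 'cV[C]_n) :
  (u^t* *m A *m v) 0 0 = \sum_i \sum_j (u i 0)^* * A i j * v j 0.
Proof.
rewrite mxE; under eq_bigr => j _ do rewrite mxE big_distrl /=.
rewrite exchange_big; apply: eq_bigr => i _; apply: eq_bigr => j _.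
by rewrite !mxE.
Qed.

Lemma quad_form_delta n (A : 'M[C]_n) i j :
  ((delta_mx i 0 : 'cV[C]_n)^t* *m A *m (delta_mx j 0 : 'cV[C]_n)) 0 0 = A i j.
Proof.
by rewrite trmx_delta map_delta_mx -rowE -colE !mxE.
Qed.

Lemma delta_mul_adj n (i j : 'I_n) :
  (delta_mx i 0 : 'cV[C]_n) *m (delta_mx j 0 : 'cV[C]_n)^t* = delta_mx i j.
Proof. by rewrite trmx_delta map_delta_mx mul_delta_mx. Qed.

Lemma mxtrace_mul_adj m n (A B : 'M[C]_(m, n)) :
  \tr (A *m B^t*) = \sum_i \sum_j A i j * (B i j)^*.
Proof.
by apply: eq_bigr => i _; rewrite mxE; apply: eq_bigr => j _; rewrite !mxE.
Qed.

Lemma mxtrace_mul_adj_ge0 m n (A : 'M[C]_(m, n)) : 0 <= \tr (A *m A^t*).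
Proof.
rewrite mxtrace_mul_adj; apply: sumr_ge0 => i _; apply: sumr_ge0 => j _.
exact: mul_conjC_ge0.
Qed.

Lemma adj_mul m n p (A : 'M[C]_(m, n)) (B : 'M[C]_(n, p)) :
  (A *m B)^t* = B^t* *m A^t*.
Proof. by rewrite trmx_mul map_mxM. Qed.

(** Gram-Schmidt on a basis of the row space gives [Q]; then [Q^t* *m Q] is the orthogonal
    projection onto that space and fixes the rows of [M]. *)
Lemma orthonormal_row_base m n (M : 'M[C]_(m, n)) :
  exists2 Q : 'M[C]_(\rank M, n),
    Q *m Q^t* = 1%:M & M *m Q^t* *m Q = M.
Proof.
pose Q := schmidt (row_base M).
have Qu : Q *m Q^t* = 1%:M.
  by apply/unitarymxP/schmidt_unitarymx/rank_leq_col.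
exists Q => //.
suff: forall X : 'M[C]_(m, n), (X <= Q)%MS -> X *m Q^t* *m Q = X.
  by apply; have := schmidt_sub (row_base M); rewrite eq_row_base.
by move=> _ /submxP[D ->]; rewrite -!mulmxA [Q *m _]mulmxA Qu mul1mx.
Qed.

(* With Q an orthonormal basis of the row space of M, this is
   0 <= |M - t Q^* Q|^2 for t = tr M / rank M. *)
Lemma mxtrace_rank_le n (M : 'M[C]_n) r : (\rank M <= r)%N ->
  `|\tr M| ^+ 2 <= r%:R * \tr (M *m M^t*).
Proof.
move=> rM.
have [M0|Mn0] := eqVneq (\rank M) 0%N.
  have -> : M = 0 by apply/eqP; rewrite -mxrank_eq0 M0.
  by rewrite mul0mx mxtrace0 normr0 expr0n mulr0.
have [] := orthonormal_row_base M.
move: (\rank M) Mn0 rM => k Mn0 kr Q Qu MQ.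
have k0 : 0 < k%:R :> C by rewrite ltr0n lt0n.
apply: (@le_trans _ _ (k%:R * \tr (M *m M^t*))); last first.
  by rewrite ler_wpM2r ?mxtrace_mul_adj_ge0 // ler_nat.
pose t := \tr M / k%:R; pose P := Q^t* *m Q.
have adjP : P^t* = P by rewrite /P adj_mul trmxCK.
have trE : \tr (M *m P) = \tr M by rewrite /P mulmxA MQ.
have trE' : \tr (P *m M^t*) = (\tr M)^*.
  rewrite -trE -[P in LHS]adjP -adj_mul.
  by rewrite -[(\tr _)^*]trace_map_mx -map_trmx mxtrace_tr.
have trP : \tr (P *m P) = k%:R.
  by rewrite /P mulmxA mxtrace_mulC !mulmxA Qu mul1mx Qu mxtrace1.
have := mxtrace_mul_adj_ge0 (M - t *: P).
have -> : (M - t *: P)^t* = M^t* - t^* *: P.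
  by rewrite linearB linearZ /= map_mxB map_mxZ adjP.
rewrite mulmxBl !mulmxBr -!scalemxAl -!scalemxAr !linearB !linearZ /=.
rewrite trE trE' trP.
have tc : t^* = (\tr M)^* / k%:R by rewrite /t rmorphM fmorphV rmorph_nat.
have -> : \tr (M *m M^t*) - t^* * \tr M - (t * (\tr M)^* - t * (t^* * k%:R))
   = \tr (M *m M^t*) - `|\tr M| ^+ 2 / k%:R.
  rewrite tc /t normCK; field; exact: lt0r_neq0.
by rewrite subr_ge0 ler_pdivrMr // mulrC.
Qed.

(** Polarization: the form is real at e_i + c e_j, hence so is c A_ij + c^* A_ji; the choices c = 1
    and c = 'i make A_ji the conjugate of A_ij. *)
Lemma pos_form_hermitian n (A : 'M[C]_n) :
  (forall v : 'cV[C]_n, 0 <= (v^t* *m A *m v) 0 0) -> A^t* = A.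
Proof.
move=> posA; apply/matrixP => i j; rewrite !mxE.
pose f (v : 'cV[C]_n) (w : 'cV[C]_n) := \tr (v^t* *m A *m w).
have f_real v : f v v \is Num.real.
  by rewrite /f trace_mx11; apply/ger0_real/posA.
have fE a b : f (delta_mx a 0) (delta_mx b 0) = A a b.
  by rewrite /f trace_mx11 quad_form_delta.
have real2 c : A i i + c * A i j + c^* * A j i + c^* * c * A j j \is Num.real.
  pose v : 'cV[C]_n := delta_mx i 0 + c *: delta_mx j 0.
  suff <- : f v v = A i i + c * A i j + c^* * A j i + c^* * c * A j j.
    exact: f_real.
  have adjv : v^t* = (delta_mx i 0)^t* + c^* *: (delta_mx j 0)^t*.
    by apply/matrixP => a b; rewrite !mxE rmorphD rmorphM.
  rewrite -!fE /f adjv /v !mulmxDl !mulmxDr -!scalemxAl -!scalemxAr.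
  rewrite !linearD !linearZ /=; ring.
have realA k : A k k \is Num.real by rewrite -fE.
have real3 c : c * A i j + c^* * A j i \is Num.real.
  have := real2 c.
  have -> : A i i + c * A i j + c^* * A j i + c^* * c * A j j =
    c * A i j + c^* * A j i + (A i i + c^* * c * A j j) by ring.
  by rewrite rpredDr // rpredD // rpredM // mulrC ger0_real // mul_conjC_ge0.
have := real3 1; rewrite rmorph1 !mul1r => /CrealP; rewrite rmorphD.
have := real3 'i; rewrite conjCi => /CrealP.
rewrite rmorphD !rmorphM rmorphN /= conjCi => e2 e1.
have i0 := neq0Ci C.
have e3 : (A j i)^* - (A i j)^* = A i j - A j i.
  apply: (mulfI i0); transitivity (- 'i * (A i j)^* + - - 'i * (A j i)^*).
    by ring.
  by apply: (etrans e2); ring.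
have : 2%:R * (A j i)^* = 2%:R * A i j.
  transitivity ((A i j)^* + (A j i)^* + ((A j i)^* - (A i j)^*)); first by ring.
  by rewrite e1 e3; ring.
by move/(mulfI _); apply; rewrite pnatr_eq0.
Qed.

(** [A] is Hermitian, hence unitarily diagonalizable; its eigenvalues are values of the form, so
    nonnegative, and [B] is built from their square roots. *)
Lemma pos_form_factor n (A : 'M[C]_n) :
  (forall v : 'cV[C]_n, 0 <= (v^t* *m A *m v) 0 0) ->
  exists B : 'M[C]_n, A = B *m B^t*.
Proof.
move=> posA.
have /orthomx_spectralP defA : A \is normalmx.
  by apply/normalmxP; rewrite (pos_form_hermitian posA).
have Pu := spectral_unitarymx A.
move: (spectralmx A) (spectral_diag A) Pu defA => P s Pu defA.
rewrite invmx_unitary // in defA.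
have PP : P *m P^t* = 1%:M by apply/unitarymxP.
have s0 i : 0 <= s 0 i.
  have := posA (P^t* *m delta_mx i 0).
  rewrite defA adj_mul trmxCK !mulmxA -[_ *m P *m P^t*]mulmxA PP mulmx1.
  by rewrite -[_ *m P *m P^t*]mulmxA PP mulmx1 quad_form_delta !mxE eqxx.
exists (P^t* *m diag_mx (\row_i sqrtC (s 0 i))).
rewrite adj_mul trmxCK !mulmxA -[P^t* *m _ *m _]mulmxA.
suff <- : diag_mx s = diag_mx (\row_i sqrtC (s 0 i)) *m
    (diag_mx (\row_i sqrtC (s 0 i)))^t* by rewrite defA.
rewrite tr_diag_mx map_diag_mx mulmx_diag; congr diag_mx.
apply/rowP => i; rewrite !mxE -normCK.
by rewrite ger0_norm ?sqrtC_ge0 // sqrtCK.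
Qed.

End ClosedField.

(** * k-positivity as a condition on families of vectors *)

Definition tens_form (C : numClosedFieldType) k d (L : 'M[C]_d -> 'M[C]_d)
    (x w : 'I_k -> 'cV[C]_d) : C :=
  \sum_a \sum_b ((w a)^t* *m L (x a *m (x b)^t*) *m w b) 0 0.

(** Padding e_i and e_j with zero vectors lets positivity at any nonzero level control the diagonal
    entries of L(E_ii). *)
Lemma tens_form_diag (C : numClosedFieldType) k d
    (L : {linear 'M[C]_d -> 'M[C]_d}) i j :
  let x l (a : 'I_k.+1) : 'cV[C]_d := if a == ord0 then delta_mx l 0 else 0 in
  tens_form L (x i) (x j) = L (delta_mx i i) j j.
Proof.
move=> x; rewrite /tens_form (bigD1 ord0) //= (bigD1 ord0) //= /x eqxx.
rewrite delta_mul_adj quad_form_delta.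
rewrite !big1 ?addr0 // => [a /negPf a0|a /negPf a0].
  rewrite big1 // => b _; rewrite a0.
  by rewrite trmx0 map_mx0 !mul0mx mxE.
by rewrite a0 mulmx0 mxE.
Qed.

Section PositivityForms.
Variable R : realType.
Local Notation C := R[i].

Definition tens_part k d (a : 'I_k) (v : 'cV[C]_(k * d)) : 'cV[C]_d :=
  \col_i v (mxtens.mxtens_index (a, i)) 0.

Definition tens_join k d (x : 'I_k -> 'cV[C]_d) : 'cV[C]_(k * d) :=
  \col_s x (mxtens.mxtens_unindex s).1 (mxtens.mxtens_unindex s).2 0.

Lemma tens_joinK k d (x : 'I_k -> 'cV[C]_d) a : tens_part a (tens_join x) = x a.
Proof.
by apply/matrixP => i j; rewrite !mxE mxtens.mxtens_indexK /= (ord1 j).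
Qed.

Lemma sum_mxtens (V : nmodType) k d (F : 'I_(k * d) -> V) :
  \sum_s F s = \sum_a \sum_i F (mxtens.mxtens_index (a, i)).
Proof.
rewrite pair_big (reindex (@mxtens.mxtens_index k d)) /=; last first.
  exists (@mxtens.mxtens_unindex k d) => s _.
    exact: mxtens.mxtens_indexK.
  exact: mxtens.mxtens_unindexK.
by apply: eq_bigr => -[a i].
Qed.

Lemma id_tensE k d (L : {linear 'M[C]_d -> 'M[C]_d}) X (a b : 'I_k) i j :
  id_tens L X (mxtens.mxtens_index (a, i)) (mxtens.mxtens_index (b, j))
  = L (tens_block a b X) i j.
Proof.
rewrite /id_tens summxE (bigD1 a) //= summxE (bigD1 b) //=.
rewrite mxtens.tensmxE mxE !eqxx mul1r !big1 ?addr0 // => [a' na|b' nb].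
  rewrite summxE big1 // => b' _.
  by rewrite mxtens.tensmxE mxE eq_sym (negPf na) mul0r.
by rewrite mxtens.tensmxE mxE eqxx /= eq_sym (negPf nb) mul0r.
Qed.

Lemma id_tens_form k d (L : {linear 'M[C]_d -> 'M[C]_d}) X
    (v : 'cV[C]_(k * d)) :
  (v^t* *m id_tens L X *m v) 0 0 =
  \sum_a \sum_b
    ((tens_part a v)^t* *m L (tens_block a b X) *m tens_part b v) 0 0.
Proof.
rewrite quad_formE sum_mxtens; apply: eq_bigr => a _.
under [RHS]eq_bigr => b _ do rewrite quad_formE.
rewrite [RHS]exchange_big; apply: eq_bigr => i _ /=.
rewrite sum_mxtens; apply: eq_bigr => b _; apply: eq_bigr => j _.
by rewrite id_tensE !mxE.
Qed.

Lemma tens_block_rank1 k d (a b : 'I_k) (y : 'cV[C]_(k * d)) :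
  tens_block a b (y *m y^t*) = tens_part a y *m (tens_part b y)^t*.
Proof.
by apply/matrixP => i j; rewrite !mxE !big_ord1 !mxE.
Qed.

Lemma tens_block_sum k d (a b : 'I_k) I r (P : pred I)
    (F : I -> 'M[C]_(k * d)) :
  tens_block a b (\sum_(l <- r | P l) F l) =
  \sum_(l <- r | P l) tens_block a b (F l).
Proof.
apply/matrixP => i j; rewrite !mxE !summxE.
by apply: eq_bigr => l _; rewrite mxE.
Qed.

(** The families [x] and [w] are the components of two vectors of C^k (x) C^d, and [tens_form L x w]
    evaluates id (x) L, applied to the rank-one matrix of [x], at [w]. Rank-one matrices suffice,
    since a factorization B B^* is a sum over the columns of [B]. *)
Lemma k_positiveP k d (L : {linear 'M[C]_d -> 'M[C]_d}) :
  k_positive k L <-> forall x w : 'I_k -> 'cV[C]_d, 0 <= tens_form L x w.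
Proof.
split=> [posL x w | posL X /pos_form_factor[B ->] v].
  have psdX : psd (tens_join x *m (tens_join x)^t*).
    move=> v; rewrite mulmxA -mulmxA -[X in _ *m X]trmxCK adj_mul trmxCK.
    rewrite mxE big_ord1 !mxE; exact: mul_conjC_ge0.
  have := posL _ psdX (tens_join w); rewrite id_tens_form.
  congr (0 <= _); apply: eq_bigr => a _; apply: eq_bigr => b _.
  by rewrite tens_block_rank1 !tens_joinK.
have -> : B *m B^t* = \sum_l col l B *m (col l B)^t*.
  apply/matrixP => i j; rewrite mxE summxE; apply: eq_bigr => l _.
  by rewrite !mxE big_ord1 !mxE.
rewrite id_tens_form.
pose F l := tens_form L (fun a => tens_part a (col l B))
                        (fun a => tens_part a v).
suff -> : \sum_a \sum_b ((tens_part a v)^t* *m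
    L (tens_block a b (\sum_l col l B *m (col l B)^t*)) *m tens_part b v) 0 0
    = \sum_l F l by apply: sumr_ge0 => l _; apply: posL.
rewrite /F /tens_form [RHS]exchange_big; apply: eq_bigr => a _.
rewrite [RHS]exchange_big; apply: eq_bigr => b _ /=.
rewrite tens_block_sum linear_sum mulmx_sumr mulmx_suml summxE.
by apply: eq_bigr => l _; rewrite tens_block_rank1.
Qed.

End PositivityForms.

(** * The maps Psi a p q and the witness *)

Section SymplecticForm.
Variables (C : numClosedFieldType) (n : nat) (J : 'M[C]_n).
Hypotheses (J_real : entry_conj J = J) (J_antisym : J^T = - J)
  (J_orth : J *m J^t* = 1%:M).

Let e i : 'cV[C]_n := delta_mx i 0.

Lemma J_adj : J^t* = - J.
Proof. by rewrite J_antisym map_mxN J_real. Qed.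

Lemma J_orthl : J^t* *m J = 1%:M.
Proof. exact: mulmx1C J_orth. Qed.

Definition Psi (a p q : C) (Z : 'M[C]_n) : 'M[C]_n :=
  (a * \tr Z) *: 1%:M + p *: Z^T + q *: (J *m Z *m J^t*).

Lemma Psi_is_linear a p q : linear (Psi a p q).
Proof.
move=> c Y Z; rewrite /Psi !linearP /= !linearD /= mulmxDl -scalemxAl.
move: (_ *m _ *m _) (_ *m _ *m _) => U V.
apply/matrixP => i j; rewrite !mxE.
ring.
Qed.

HB.instance Definition _ a p q :=
  GRing.isLinear.Build C 'M[C]_n 'M[C]_n _ (Psi a p q) (Psi_is_linear a p q).

Definition J_conj (L : 'M[C]_n -> 'M[C]_n) (Z : 'M[C]_n) : 'M[C]_n :=
  J^t* *m L Z *m J.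

Lemma tens_form_J_conj k L (x w : 'I_k -> 'cV[C]_n) :
  tens_form (J_conj L) x w = tens_form L x (fun a => J *m w a).
Proof.
apply: eq_bigr => a _; apply: eq_bigr => b _.
by rewrite adj_mul /J_conj !mulmxA.
Qed.

Lemma mxtrace_col_row (x : 'cV[C]_n) (y : 'rV[C]_n) :
  \tr (x *m y) = (y *m x) 0 0.
Proof. by rewrite mxtrace_mulC trace_mx11. Qed.

Lemma mx11M (x y : 'M[C]_1) : (x *m y) 0 0 = x 0 0 * y 0 0.
Proof. by rewrite mxE big_ord1. Qed.

Lemma mxtrace_mul_sums k (F G : 'I_k -> 'M[C]_n) :
  \tr ((\sum_s F s) *m (\sum_t G t)) = \sum_s \sum_t \tr (F s *m G t).
Proof.
rewrite mulmx_suml linear_sum; apply: eq_bigr => s _ /=.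
by rewrite mulmx_sumr linear_sum.
Qed.

Lemma Psi_form k a p q (x w : 'I_k -> 'cV[C]_n)
    (A := \sum_c x c *m (w c)^t* : 'M[C]_n) :
  tens_form (Psi a p q) x w
  = a * \tr (A *m A^t*) + p * \tr (A *m entry_conj A)
    + q * `|\tr (J *m A)| ^+ 2.
Proof.
have conjA : entry_conj A = \sum_c entry_conj (x c) *m (w c)^T.
  rewrite /A raddf_sum; apply: eq_bigr => c _ /=.
  by rewrite map_mxM map_mxCK.
have adjA : A^t* = \sum_c w c *m (x c)^t*.
  rewrite /A !raddf_sum; apply: eq_bigr => c _ /=.
  by rewrite adj_mul trmxCK.
have trJ : \tr (J *m A) = \sum_c ((w c)^t* *m J *m x c) 0 0.
  rewrite /A mulmx_sumr linear_sum; apply: eq_bigr => c _ /=.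
  by rewrite mulmxA mxtrace_col_row mulmxA.
have trJ' : (\tr (J *m A))^* = \sum_c ((x c)^t* *m J^t* *m w c) 0 0.
  rewrite -trace_map_mx -mxtrace_tr map_trmx adj_mul adjA mulmx_suml linear_sum.
  apply: eq_bigr => c _ /=.
  by rewrite -mulmxA mxtrace_col_row.
rewrite normCK trJ' trJ adjA conjA /A !mxtrace_mul_sums big_distrlr /=.
rewrite !mulr_sumr -!big_split; apply: eq_bigr => s _ /=.
rewrite !mulr_sumr -!big_split; apply: eq_bigr => t _ /=.
rewrite /Psi !mulmxDr !mulmxDl -!scalemxAr -!scalemxAl !mxtrace_col_row.
rewrite [LHS]mxE [X in X + _ = _]mxE; congr (_ + _ + _).
- rewrite mxE mulmx1 -mulrA -mx11M; congr (_ * _).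
  by rewrite !mulmxA mxtrace_col_row !mulmxA.
- rewrite mxE trmx_mul; congr (_ * _).
  have -> : (x t)^t*^T = entry_conj (x t) by rewrite map_trmx trmxK.
  have tr_swap : ((x s)^T *m w t) 0 0 = ((w t)^T *m x s) 0 0.
    by rewrite -[LHS]trace_mx11 -mxtrace_tr trmx_mul trmxK trace_mx11.
  rewrite !mulmxA mxtrace_col_row -(mulmxA _ _ (w t)) mx11M tr_swap.
  by rewrite -[x s *m _ *m _]mulmxA mulmxA mx11M mulrC.
- by rewrite mxE -mx11M !mulmxA.
Qed.

Lemma antisym_part_trace (A : 'M[C]_n) (B := A - A^T : 'M[C]_n) :
  \tr (B *m B^t*) = (\tr (A *m A^t*) - \tr (A *m entry_conj A)) *+ 2.
Proof.
have -> : B^t* = A^t* - entry_conj A.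
  by rewrite /B linearB /= trmxK map_mxB.
rewrite /B mulmxBl !mulmxBr !linearB /=.
have -> : \tr (A^T *m A^t*) = \tr (A *m entry_conj A).
  by rewrite -map_trmx -mxtrace_tr trmx_mul !trmxK mxtrace_mulC.
have -> : \tr (A^T *m entry_conj A) = \tr (A *m A^t*).
  by rewrite -mxtrace_tr trmx_mul trmxK map_trmx mxtrace_mulC.
by rewrite opprB mulr2n.
Qed.

(* For B = A - A^T the form is |B|^2 / 2 - c |tr (J B)|^2 / 4, and J B has rank
   at most min (2 k, n). *)
Lemma Psi_pos k c r (x w : 'I_k -> 'cV[C]_n) :
    (minn k.*2 n <= r)%N -> 0 <= c -> c * r%:R <= 2 ->
  0 <= tens_form (Psi 1 (-1) (- c)) x w.
Proof.
move=> le_r c0 cr; rewrite Psi_form mul1r mulN1r mulNr.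
set A := \sum_s _; pose B := A - A^T.
have rkA : (\rank A <= k)%N.
  have -> : A = (\matrix_(i, a) x a i 0) *m (\matrix_(i, a) w a i 0)^t*.
    apply/matrixP => i j; rewrite summxE mxE; apply: eq_bigr => a _.
    by rewrite !mxE big_ord1 !mxE.
  exact: mulmx_max_rank.
have rkJB : (\rank (J *m B) <= r)%N.
  apply: leq_trans le_r; rewrite leq_min rank_leq_row andbT.
  apply: leq_trans (mxrankM_maxr _ _) _; apply: leq_trans (mxrank_add _ _) _.
  by rewrite mxrank_opp mxrank_tr -addnn leq_add.
have trJB : \tr (J *m B) = \tr (J *m A) *+ 2.
  rewrite /B mulmxBr linearB /= -[\tr (J *m A^T)]mxtrace_tr trmx_mul trmxK.
  by rewrite J_antisym mulmxN linearN /= opprK mxtrace_mulC.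
have normJB : \tr (J *m B *m (J *m B)^t*) = \tr (B *m B^t*).
  rewrite adj_mul mxtrace_mulC !mulmxA -[_ *m J^t* *m J]mulmxA J_orthl mulmx1.
  exact: mxtrace_mulC.
have := mxtrace_rank_le rkJB.
rewrite trJB normJB normrMn exprMn_n (antisym_part_trace A) => le_tr.
have := mxtrace_mul_adj_ge0 B; rewrite (antisym_part_trace A) pmulrn_lge0 //.
move: le_tr; set t := `|_| ^+ 2; set D := \tr _ - \tr _ => le_tr D0.
(* With t = |tr(J A)|^2 and |B|^2 = 2 D the rank bound reads 4 t <= 2 r D. Multiplying by c and
   using c r <= 2 gives 4 c t <= 4 D. *)
rewrite subr_ge0 -(ler_pMn2r (n := 4)) // -mulrnAr.
apply: (@le_trans _ _ (c * r%:R * (D *+ 2))).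
  by rewrite -mulrA ler_wpM2l.
have -> : D *+ 4 = 2 * (D *+ 2) by ring.
by rewrite ler_wpM2r // mulrn_wge0.
Qed.

(** The operator 1 + flip is positive on symmetric tensors: the families (e_i, e_j) and (e_j, e_i)
    test L on e_i (x) e_j + e_j (x) e_i, and summing over all i and j counts the target twice. *)
Lemma sum_swap_ge0 (L : 'M[C]_n -> 'M[C]_n) :
    (forall x w : 'I_2 -> 'cV[C]_n, 0 <= tens_form L x w) ->
  0 <= \sum_i \sum_j (L (delta_mx i i) j j + L (delta_mx i j) j i).
Proof.
move=> posL; rewrite -(pmulrn_lge0 _ (isT : (0 < 2)%N)) mulr2n.
rewrite [X in _ + X]exchange_big -big_split /=; apply: sumr_ge0 => i _.
rewrite -big_split /=; apply: sumr_ge0 => j _.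
have := posL (fun c => if c == 0 then e i else e j)
             (fun c => if c == 0 then e j else e i).
rewrite /tens_form !big_ord_recl !big_ord0 !addr0 /= !delta_mul_adj.
rewrite !quad_form_delta.
by congr (0 <= _); ring.
Qed.

(* The pairing of the Choi matrix of L with the PPT operator
   1 + flip + (1 (x) J) |omega><omega| (1 (x) J)^*,
   where omega = \sum_i e_i (x) e_i. *)
Definition witness (L : 'M[C]_n -> 'M[C]_n) : C :=
  \sum_i \sum_j (L (delta_mx i i) j j + L (delta_mx i j) j i)
  + \sum_i \sum_j J_conj L (delta_mx i j) i j.

Lemma diag_form_ge0 (L : 'M[C]_n -> 'M[C]_n) :
    (forall x w : 'I_n -> 'cV[C]_n, 0 <= tens_form L x w) ->
  0 <= \sum_i \sum_j L (delta_mx i j) i j.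
Proof.
move/(_ e e); congr (0 <= _); apply: eq_bigr => i _; apply: eq_bigr => j _.
by rewrite delta_mul_adj quad_form_delta.
Qed.

Lemma witness_ge0 (L : 'M[C]_n -> 'M[C]_n) :
    (forall k (x w : 'I_k -> 'cV[C]_n), 0 <= tens_form L x w) ->
  0 <= witness L.
Proof.
move=> posL; apply: addr_ge0; first exact: sum_swap_ge0.
by apply: diag_form_ge0 => x w; rewrite tens_form_J_conj.
Qed.

Lemma J_conjK (M : 'M[C]_n) : J^t* *m (J^t* *m M *m J) *m J = M.
Proof.
have JJ : J *m J = - 1%:M by rewrite -J_orth J_adj mulmxN opprK.
rewrite !mulmxA J_adj mulNmx mulmxN opprK JJ -!mulmxA JJ.
by rewrite mulNmx mul1mx mulmxN opprK mulmx1.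
Qed.

Let trE (M : 'M[C]_n) i j : M^T i j = M j i.
Proof. exact: mxE. Qed.

(** Transposing the output amounts to a partial transpose of the operator paired with the Choi
    matrix. This exchanges the flip and |omega><omega|, so conjugation by 1 (x) J recovers the
    original operator; the witness is thus nonnegative on co-CP maps as well. *)
Lemma witness_tr (L : 'M[C]_n -> 'M[C]_n) :
  witness (trmx \o L) = witness (J_conj L).
Proof.
have trJ i : \sum_j L (delta_mx i i) j j = \sum_j J_conj L (delta_mx i i) j j.
  rewrite -[LHS]/(\tr _) -[RHS]/(\tr _) /J_conj [RHS]mxtrace_mulC mulmxA.
  by rewrite J_orth mul1mx.
have trJ' i j : J_conj (trmx \o L) (delta_mx i j) i j
    = J_conj L (delta_mx i j) j i.
  rewrite -trE /J_conj /= !trmx_mul trmxK mulmxA.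
  by rewrite map_trmx trmxK J_real J_adj J_antisym.
rewrite /witness.
under eq_bigr => i _ do rewrite big_split /=.
under [in RHS]eq_bigr => i _ do rewrite big_split /=.
rewrite !big_split /= -!addrA; congr (_ + _).
  by apply: eq_bigr => i _; rewrite -trJ; apply: eq_bigr => j _; rewrite mxE.
rewrite addrC; congr (_ + _); apply: eq_bigr => i _; apply: eq_bigr => j _.
  exact: trJ'.
by rewrite /J_conj J_conjK mxE.
Qed.

Lemma J_conj_Psi a p q (Z : 'M[C]_n) : J_conj (Psi a p q) Z
  = (a * \tr Z) *: 1%:M + p *: (J^t* *m Z^T *m J) + q *: Z.
Proof.
rewrite /J_conj /Psi !mulmxDr !mulmxDl -!scalemxAr -!scalemxAl mulmx1 J_orthl.
by rewrite !mulmxA J_orthl mul1mx -(mulmxA Z) J_orthl mulmx1.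
Qed.

Lemma sum_J_sqr : \sum_i \sum_j J i j * J i j = n%:R.
Proof.
rewrite -[RHS]mxtrace1 -J_orth mxtrace_mul_adj.
apply: eq_bigr => i _; apply: eq_bigr => j _.
by congr (_ * _); rewrite -[in LHS]J_real mxE.
Qed.

Let Jsym i j : J j i = - J i j.
Proof. by rewrite -trE J_antisym mxE. Qed.

Let Jc i j : (J i j)^* = J i j.
Proof. by rewrite -[in RHS]J_real mxE. Qed.

Let JEJ (i j k l : 'I_n) (A B : 'M[C]_n) :
  (A *m delta_mx i j *m B) k l = A k i * B j l.
Proof.
rewrite -(mul_delta_mx (0 : 'I_1)) mulmxA -mulmxA mxE big_ord1 -colE -rowE.
by rewrite !mxE.
Qed.

Let trd (i j : 'I_n) : \tr (delta_mx i j : 'M[C]_n) = (i == j)%:R.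
Proof.
rewrite -(mul_delta_mx (0 : 'I_1)) mxtrace_mulC mul_delta_mx_cond.
by rewrite linearMn /= trace_mx11 mxE eqxx eq_sym.
Qed.

Lemma J_conj_Psi_delta a p q i j : J_conj (Psi a p q) (delta_mx i j) i j
  = a * (i == j)%:R - p * (J i j * J i j) + q.
Proof.
have := JEJ j i i j (J^t*) J; rewrite J_conj_Psi trmx_delta.
move: (J^t* *m _ *m _) => U UE.
rewrite !mxE UE trd !mxE !eqxx Jc [J j i]Jsym.
by case: (_ == _) => /=; ring.
Qed.

(** [E1] (summed over i), [S2] and [S3] are the contributions of the identity, the flip and the
    twisted |omega><omega|. Their terms linear in n cancel for [p] and [q] but add up for [a]. *)
Lemma witness_Psi a p q :
  witness (Psi a p q) = a * (n%:R ^+ 2 + n%:R *+ 2) + (p + q) * n%:R ^+ 2.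
Proof.
have E1 i : \sum_j Psi a p q (delta_mx i i) j j = a * n%:R + p + q.
  rewrite -[LHS]/(\tr _) /Psi !linearD /= !linearZ /= mxtrace1 mxtrace_tr.
  rewrite [\tr (J *m _ *m _)]mxtrace_mulC mulmxA J_orthl mul1mx.
  by rewrite trd eqxx !mulr1.
have E2 i j : Psi a p q (delta_mx i j) j i
    = a * (i == j)%:R + p - q * (J i j * J i j).
  have := JEJ i j j i J (J^t*); rewrite /Psi; move: (J *m _ *m _) => U UE.
  rewrite !mxE UE trd !mxE !eqxx Jc [J j i]Jsym [j == i]eq_sym.
  by case: (_ == _) => /=; ring.
have sumd : \sum_i \sum_j (i == j :> 'I_n)%:R = n%:R :> C.
  rewrite -[RHS]mxtrace1; apply: eq_bigr => i _; rewrite mxE eqxx (bigD1 i) //=.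
  by rewrite eqxx big1 ?addr0 // => j /negPf nj; rewrite eq_sym nj.
have sumc (c : C) : \sum_(i < n) \sum_(j < n) c = n%:R ^+ 2 * c.
  by rewrite !sumr_const card_ord -mulrnA -natrX mulr_natl.
have S2 : \sum_i \sum_j Psi a p q (delta_mx i j) j i
    = a * n%:R + n%:R ^+ 2 * p - q * n%:R.
  under eq_bigr => i _ do under eq_bigr => j _ do rewrite E2.
  under eq_bigr => i _ do rewrite sumrB big_split /= -!mulr_sumr.
  by rewrite sumrB big_split /= -!mulr_sumr sumd sumc sum_J_sqr.
have S3 : \sum_i \sum_j J_conj (Psi a p q) (delta_mx i j) i j
    = a * n%:R - p * n%:R + n%:R ^+ 2 * q.
  under eq_bigr => i _ do under eq_bigr => j _ do rewrite J_conj_Psi_delta.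
  under eq_bigr => i _ do rewrite big_split /= sumrB -!mulr_sumr.
  by rewrite big_split /= sumrB -!mulr_sumr sumd sumc sum_J_sqr.
rewrite /witness S3.
under eq_bigr => i _ do rewrite big_split /= E1.
rewrite big_split /= S2 sumr_const card_ord -mulr_natl; ring.
Qed.

Lemma witnessD (L L1 L2 : 'M[C]_n -> 'M[C]_n) :
  (forall Z, L Z = L1 Z + L2 Z) -> witness L = witness L1 + witness L2.
Proof.
move=> LE; rewrite /witness addrACA; congr (_ + _).
  rewrite -big_split; apply: eq_bigr => i _; rewrite -big_split.
  by apply: eq_bigr => j _; rewrite !LE !mxE addrACA.
rewrite -big_split; apply: eq_bigr => i _; rewrite -big_split.
by apply: eq_bigr => j _; rewrite /J_conj LE mulmxDr mulmxDl mxE.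
Qed.

Lemma eq_witness (L L' : 'M[C]_n -> 'M[C]_n) :
  L =1 L' -> witness L = witness L'.
Proof.
move=> eqL; congr (_ + _); apply: eq_bigr => i _; apply: eq_bigr => j _.
  by rewrite !eqL.
by rewrite /J_conj eqL.
Qed.

Lemma witness_decomposable_ge0 (L L1 L2 : 'M[C]_n -> 'M[C]_n) :
    (forall k (x w : 'I_k -> 'cV[C]_n), 0 <= tens_form L1 x w) ->
    (forall k (x w : 'I_k -> 'cV[C]_n), 0 <= tens_form (trmx \o L2) x w) ->
    (forall Z, L Z = L1 Z + L2 Z) ->
  0 <= witness L.
Proof.
move=> pos1 pos2 /witnessD->; apply: addr_ge0; first exact: witness_ge0.
rewrite (@eq_witness L2 (trmx \o (trmx \o L2))); last first.
  by move=> Z; rewrite /= trmxK.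
by rewrite witness_tr; apply: witness_ge0 => k x w; rewrite tens_form_J_conj.
Qed.

Lemma eq_tens_form k (L L' : 'M[C]_n -> 'M[C]_n) (x w : 'I_k -> 'cV[C]_n) :
  L =1 L' -> tens_form L x w = tens_form L' x w.
Proof.
by move=> eqL; apply: eq_bigr => a _; apply: eq_bigr => b _; rewrite eqL.
Qed.

Lemma J_conj_forms k (L : 'M[C]_n -> 'M[C]_n) :
  (forall x w : 'I_k -> 'cV[C]_n, 0 <= tens_form (J_conj L) x w) <->
  (forall x w : 'I_k -> 'cV[C]_n, 0 <= tens_form L x w).
Proof.
split=> posL x w; last by rewrite tens_form_J_conj.
have JK (u : 'cV[C]_n) : J *m (J^t* *m u) = u by rewrite mulmxA J_orth mul1mx.
have := posL x (fun a => J^t* *m w a); rewrite tens_form_J_conj.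
congr (0 <= _); apply: eq_bigr => a _; apply: eq_bigr => b _.
by rewrite !JK.
Qed.

(** The form of [Psi 0 0 p] is p |tr(J A)|^2, and [J_conj] turns this map into multiplication by
    p. *)
Lemma scale_forms k p (x w : 'I_k -> 'cV[C]_n) :
  0 <= p -> 0 <= tens_form (fun Z => p *: Z) x w.
Proof.
move=> p0; rewrite (@eq_tens_form _ _ (J_conj (Psi 0 0 p))); last first.
  by move=> Z; rewrite J_conj_Psi mul0r !scale0r !add0r.
rewrite tens_form_J_conj Psi_form !mul0r !add0r.
by rewrite mulr_ge0 // exprn_ge0.
Qed.

(** [Psi a (- a) q] is a times [Psi 1 (-1) (- c)] plus q + a c times the CP map sending Z to J Z
    J^*. The rank bound r = n does not depend on k, which gives positivity at every level. *)
Lemma Psi_forms_ge0 k a q c (x w : 'I_k -> 'cV[C]_n) :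
    0 <= a -> 0 <= c -> c * n%:R <= 2 -> 0 <= q + a * c ->
  0 <= tens_form (Psi a (- a) q) x w.
Proof.
move=> a0 c0 cn qac; have := Psi_pos x w (geq_minr k.*2 n) c0 cn.
rewrite !Psi_form; set A := \sum_c _; set u := `|_| ^+ 2.
move: (\tr (A *m entry_conj A)) (\tr (A *m _)) => t s pos.
have -> : a * s + - a * t + q * u
  = a * (1 * s + -1 * t + - c * u) + (q + a * c) * u by ring.
by rewrite addr_ge0 // mulr_ge0 // exprn_ge0.
Qed.

Lemma trmx_Psi_transpose p Z : (Psi 0 p 0 Z)^T = p *: Z.
Proof.
by rewrite /Psi mul0r !scale0r addr0 add0r linearZ /= trmxK.
Qed.

(** Cutting p into -a and p + a leaves a candidate for the CP part and a multiple of transposition,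
    which is co-CP when p + a >= 0. *)
Lemma Psi_split a p q Z : Psi a p q Z = Psi a (- a) q Z + Psi 0 (p + a) 0 Z.
Proof.
rewrite /Psi mul0r !scale0r add0r addr0 [RHS]addrAC; congr (_ + _).
by rewrite -addrA -scalerDl [p + a]addrC addKr.
Qed.

(** On an isotropic family the entries J_(f s, f t) vanish, so [p] drops out; the choice w = J x
    turns the [q] term into that of the identity map. *)
Lemma Psi_isotropic_form k (f : 'I_k -> 'I_n) a p q :
    injective f -> (forall s t, J (f s) (f t) = 0) ->
  tens_form (Psi a p q) (fun s => e (f s)) (fun s => J *m e (f s))
  = k%:R * (a + q * k%:R).
Proof.
move=> f_inj isoJ; rewrite -tens_form_J_conj.
transitivity (\sum_s \sum_t (a * (s == t :> 'I_k)%:R + q)).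
  apply: eq_bigr => s _; apply: eq_bigr => t _.
  rewrite delta_mul_adj quad_form_delta J_conj_Psi_delta isoJ (inj_eq f_inj).
  by rewrite !mulr0 subr0.
under eq_bigr => s _.
  rewrite big_split /= -mulr_sumr (bigD1 s) //= eqxx big1 ?addr0; last first.
    by move=> t /negPf ts; rewrite eq_sym ts.
  rewrite mulr1 sumr_const card_ord -mulr_natr.
over.
by rewrite sumr_const card_ord mulr_natl.
Qed.

End SymplecticForm.

(** * Covariant maps *)

Section Covariance.
Variables (C : numClosedFieldType) (n : nat) (J : 'M[C]_n).
Hypotheses (J_real : entry_conj J = J) (J_antisym : J^T = - J)
  (J_orth : J *m J^t* = 1%:M).

Local Notation e i := (delta_mx i 0 : 'cV[C]_n).

(** Membership in Sp and covariance are stated for a general [J], which keeps the block form of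
    Omega out of the arguments. *)
Definition symplectic (S : 'M[C]_n) := S \is unitarymx /\ S^T *m J *m S = J.

Definition covariant (L : 'M[C]_n -> 'M[C]_n) := forall S Z, symplectic S ->
  L (S *m Z *m S^t*) = entry_conj S *m L Z *m (entry_conj S)^t*.

(** Unitarity makes conj S the inverse of S^T, which can then be moved across S^T J S = J. *)
Lemma symplectic_conj S : symplectic S -> J *m S = entry_conj S *m J.
Proof.
case=> /unitarymxP SS symS.
have SS' : entry_conj S *m S^T = 1%:M.
  by rewrite -[S^T]map_mxCK -map_mxM SS map_mx1.
by rewrite -[J in RHS]symS !mulmxA SS' mul1mx.
Qed.

Lemma Psi_covariant a p q : covariant (Psi J a p q).
Proof.
move=> S Z symS; have [/unitarymxP SS _] := symS.
have SS' : S^t* *m S = 1%:M by exact: mulmx1C.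
have adjcS : (entry_conj S)^t* = S^T by rewrite -map_trmx map_mxCK.
have cSS : entry_conj S *m S^T = 1%:M.
  by rewrite -[S^T]map_mxCK -map_mxM SS map_mx1.
rewrite /Psi !mulmxDr !mulmxDl -!scalemxAr -!scalemxAl mulmx1 adjcS cSS.
congr (_ + _ *: _ + _ *: _).
- by rewrite mxtrace_mulC mulmxA SS' mul1mx.
- by rewrite !trmx_mul map_trmx trmxK mulmxA.
- rewrite !mulmxA symplectic_conj // -!mulmxA; do 3 congr (_ *m _).
  rewrite -adj_mul symplectic_conj // adj_mul adjcS //.
Qed.

(* v |-> J conj v is the quaternionic structure preserved by Sp: the eigenvalue
   on J conj v has to be the conjugate of the one on v. *)
Definition symplectic_reflection mu (v : 'cV[C]_n) (w := J *m entry_conj v) :=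
  1%:M + mu *: (v *m v^t*) + mu^* *: (w *m w^t*).

(** Here v and w are orthogonal with squared norm r, so the condition on mu says that 1 + mu r has
    modulus one, which makes S unitary. *)
Lemma symplectic_reflectionP mu v r :
    v^t* *m v = r%:R%:M -> mu + mu^* + mu * mu^* * r%:R = 0 ->
  symplectic (symplectic_reflection mu v).
Proof.
rewrite /symplectic_reflection; set w := J *m _ => vv mu_r.
have adjv : (entry_conj v)^t* = v^T by rewrite -map_trmx map_mxCK.
have adjw : w^t* = v^T *m J^t* by rewrite adj_mul adjv.
have J'J : J^t* *m J = 1%:M by exact: mulmx1C.
have ww : w^t* *m w = r%:R%:M.
  have <- : (v^t* *m v)^T = r%:R%:M by rewrite vv tr_scalar_mx.
  rewrite adjw mulmxA -(mulmxA v^T) J'J mulmx1.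
  by rewrite trmx_mul map_trmx trmxK.
(* The scalar v^* J conj v equals its own transpose, which the antisymmetry of J turns into its
   negative. *)
have vw : v^t* *m w = 0.
  have : v^t* *m w = - (v^t* *m w).
    have tr11 (P : 'M[C]_1) : P = P^T by rewrite [P]mx11_scalar tr_scalar_mx.
    rewrite [LHS]tr11 /w !trmx_mul J_antisym.
    by rewrite mulmxN mulNmx mulmxA [_^t*^T]map_trmx trmxK map_trmx.
  move/eqP; rewrite -addr_eq0 -mulr2n -scaler_nat scaler_eq0 pnatr_eq0 /=.
  by move/eqP.
have wv : w^t* *m v = 0 by rewrite -[v]trmxCK -adj_mul vw trmx0 map_mx0.
have adjP (x : 'cV[C]_n) : (x *m x^t*)^t* = x *m x^t* by rewrite adj_mul trmxCK.
have prodP (x y : 'cV[C]_n) : x *m x^t* *m (y *m y^t*)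
    = (x^t* *m y) 0 0 *: (x *m y^t*).
  rewrite mulmxA -(mulmxA x) [in LHS](mx11_scalar (x^t* *m y)) mul_mx_scalar.
  by rewrite -scalemxAl.
set S := _ + _ + _.
have SS : S *m S^t* = 1%:M.
  have -> : S^t* = 1%:M + mu^* *: (v *m v^t*) + mu *: (w *m w^t*).
    rewrite /S !linearD !linearZ /= !map_mxD !map_mxZ !adjP /= conjCK.
    by rewrite trmx1 map_mx1.
  rewrite /S !mulmxDl !mulmxDr !mul1mx !mulmx1 -!scalemxAl -!scalemxAr !prodP.
  rewrite vv ww vw wv !mxE eqxx mulr1n !scale0r !scaler0 !addr0.
  move: (v *m v^t*) (w *m w^t*) mu_r => P Q mu_r.
  apply/matrixP => i j; rewrite !mxE.
  move: (P i j) (Q i j) ((i == j)%:R) => x y z.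
  transitivity (z + (mu + mu^* + mu * mu^* * r%:R) * (x + y)); first by ring.
  by rewrite mu_r mul0r addr0.
split; first exact/unitarymxP.
(* For unitary S the condition S^T J S = J amounts to J S = (conj S) J, that is, to commuting with
   the quaternionic structure. *)
suff JS : J *m S = entry_conj S *m J.
  rewrite -mulmxA JS mulmxA -[S^T]map_mxCK -map_mxM (mulmx1C SS) map_mx1.
  exact: mul1mx.
have J'E : J^t* = J^T by rewrite -map_trmx J_real.
have JT : J^T *m J = 1%:M by rewrite -J'E.
have JJ : J *m J = - 1%:M by rewrite -JT J_antisym mulNmx opprK.
have cw : entry_conj w = J *m v by rewrite /w map_mxM J_real map_mxCK.
have Jw : J *m w = - entry_conj v by rewrite /w mulmxA JJ mulNmx mul1mx.
have cP (x : 'cV[C]_n) : entry_conj (x *m x^t*) = entry_conj x *m x^T.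
  by rewrite map_mxM map_mxCK.
have -> : entry_conj S = 1%:M + mu^* *: (entry_conj v *m v^T)
    + mu *: (entry_conj w *m w^T).
  by rewrite /S !map_mxD !map_mxZ map_mx1 /= conjCK !cP.
have wT : w^T = v^t* *m J^T by rewrite trmx_mul map_trmx.
have JvJ : v^t* *m J^T *m J = v^t* by rewrite -mulmxA JT mulmx1.
rewrite /S; clearbody w; rewrite mulmxDr !mulmxDl mulmxDr mulmx1 mul1mx.
rewrite -!scalemxAl -!scalemxAr -!mulmxA [J *m (w *m _)]mulmxA Jw cw adjw.
rewrite J'E wT JvJ J_antisym mulNmx !mulmxN opprK addrAC.
by rewrite [J *m (v *m _)]mulmxA.
Qed.

Lemma symplectic_reflectionE mu v (x : 'cV[C]_n) :
  symplectic_reflection mu v *m x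
  = x + (mu * (v^t* *m x) 0 0) *: v
    + (mu^* * ((J *m entry_conj v)^t* *m x) 0 0) *: (J *m entry_conj v).
Proof.
have outer (u : 'cV[C]_n) : u *m u^t* *m x = (u^t* *m x) 0 0 *: u.
  by rewrite -mulmxA [in LHS](mx11_scalar (u^t* *m x)) mul_mx_scalar.
rewrite /symplectic_reflection !mulmxDl mul1mx -!scalemxAl !outer.
by rewrite !scalerA.
Qed.

End Covariance.

(** * Classification of the covariant maps *)

Section Classification.
Variables (C : numClosedFieldType) (n : nat) (J : 'M[C]_n).
Hypotheses (J_real : entry_conj J = J) (J_antisym : J^T = - J)
  (J_orth : J *m J^t* = 1%:M).
(** J permutes the standard basis up to sign: [mate i] is the symplectic partner of [i], and [sgn]
    records the sign. *)
Variables (mate : 'I_n -> 'I_n) (sgn : 'I_n -> bool).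
Hypotheses (mateK : involutive mate)
  (sgn_mate : forall i, sgn (mate i) = ~~ sgn i).

Local Notation e i := (delta_mx i 0 : 'cV[C]_n).

Hypothesis J_e : forall i, J *m e i = (-1) ^+ sgn i *: e (mate i).

Local Notation symp := (symplectic J).
Local Notation cov := (covariant J).

Lemma mate_neq i : mate i != i.
Proof. by apply/eqP => mi; have := sgn_mate i; rewrite mi; case: (sgn i). Qed.

Lemma adj_delta i : (e i)^t* = delta_mx 0 i.
Proof. by rewrite trmx_delta map_delta_mx. Qed.

Lemma conj_delta i : entry_conj (e i) = e i.
Proof. exact: map_delta_mx. Qed.

Lemma delta_dot i j : ((e i)^t* *m e j) 0 0 = (i == j)%:R.
Proof. by rewrite adj_delta -rowE !mxE eqxx andbT. Qed.

Lemma adjD (x y : 'cV[C]_n) : (x + y)^t* = x^t* + y^t*.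
Proof. by rewrite linearD map_mxD. Qed.

Lemma adjZ a (x : 'cV[C]_n) : (a *: x)^t* = a^* *: x^t*.
Proof. by rewrite linearZ map_mxZ. Qed.

(** The solution of 1 + 2 mu = (3 + 4 'i) / 5, for reflections along vectors of squared norm 2. *)
Definition mu_mix : C := (-1 + 2 * 'i) / 5.

Lemma mu_mixC : mu_mix^* = (-1 - 2 * 'i) / 5.
Proof.
rewrite /mu_mix rmorphM rmorphD rmorphN rmorphM fmorphV !rmorph_nat rmorph1.
by rewrite /= conjCi mulrN.
Qed.

Let ii : 'i * 'i = -1 :> C. Proof. by rewrite -expr2 sqrCi. Qed.

Lemma mu_mix_norm : mu_mix + mu_mix^* + mu_mix * mu_mix^* * 2%:R = 0.
Proof.
rewrite mu_mixC /mu_mix.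
have -> : (-1 + 2 * 'i) / 5 * ((-1 - 2 * 'i) / 5) * 2%:R
  = (1 - 4 * ('i * 'i)) / 25 * 2 :> C by field.
by rewrite ii; field.
Qed.

(* The reflection along e_i + beta e_j. Its eigenvalue (3 + 4 i)/5 is chosen so
   that both entries x and y are nonzero, also when j is the mate of i. *)
Lemma symplectic_mixing i j : i != j ->
  exists x y : C, [/\ x != 0, y != 0 & forall beta, beta * beta^* = 1 ->
    exists S, [/\ symp S, S *m e i = x *: e i + (beta * y) *: e j &
      forall l, l \notin [:: i; j; mate i; mate j] -> S *m e l = e l]].
Proof.
move=> ij.
pose v beta := e i + beta *: e j.
have wE beta : J *m entry_conj (v beta)
    = (-1) ^+ sgn i *: e (mate i) + (beta^* * (-1) ^+ sgn j) *: e (mate j).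
  rewrite map_mxD map_mxZ !conj_delta mulmxDr -scalemxAr !J_e.
  by rewrite scalerA.
have dot_v beta l :
    ((v beta)^t* *m e l) 0 0 = (i == l)%:R + beta^* * (j == l)%:R.
  rewrite adjD adjZ mulmxDl -scalemxAl.
  by rewrite mxE delta_dot [X in _ + X]mxE delta_dot.
have dot_w beta l : ((J *m entry_conj (v beta))^t* *m e l) 0 0
    = (-1) ^+ sgn i * (mate i == l)%:R
      + beta * (-1) ^+ sgn j * (mate j == l)%:R.
  rewrite wE adjD !adjZ mulmxDl -!scalemxAl.
  rewrite mxE [X in X + _]mxE delta_dot [X in _ + X]mxE delta_dot.
  by rewrite rmorphM !rmorph_sign /= conjCK.
have symS beta : beta * beta^* = 1 ->
    symp (symplectic_reflection J mu_mix (v beta)).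
  move=> b1; apply: (@symplectic_reflectionP _ _ _ _ _ _ _ _ 2) => //.
    rewrite [LHS]mx11_scalar; congr _%:M.
    rewrite {2}/v mulmxDr -scalemxAr mxE [X in _ + X]mxE !dot_v !eqxx.
    by rewrite eq_sym (negPf ij) mulr0 mulr1 addr0 add0r b1.
  exact: mu_mix_norm.
have fixS beta l : l \notin [:: i; j; mate i; mate j] ->
    symplectic_reflection J mu_mix (v beta) *m e l = e l.
  rewrite !inE !negb_or => /and4P[li lj lmi lmj].
  rewrite symplectic_reflectionE dot_v dot_w.
  rewrite ![_ == l]eq_sym (negPf li) (negPf lj) (negPf lmi) (negPf lmj).
  by rewrite !(mulr0, addr0) !scale0r !addr0.
(* If j = mate i, both v and J conj v lie in the plane of e_i and e_j, where S has the eigenvalues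
   (3 + 4 'i) / 5 and (3 - 4 'i) / 5; their half sum and half difference are x and y. *)
have [jmi|jmi] := eqVneq j (mate i).
  exists (3 / 5), (4 * 'i / 5); split.
  - by rewrite mulf_neq0 ?invr_eq0 ?pnatr_eq0.
  - by rewrite !mulf_neq0 ?invr_eq0 ?pnatr_eq0 ?neq0Ci.
  move=> beta b1; exists (symplectic_reflection J mu_mix (v beta)).
  split; [exact: symS| |by move=> l; apply: fixS].
  rewrite symplectic_reflectionE dot_v dot_w wE.
  have mji : mate j = i by rewrite jmi mateK.
  have sj : sgn j = ~~ sgn i by rewrite jmi sgn_mate.
  rewrite mji -jmi eqxx [j == i]eq_sym (negPf ij) !(mulr0, mulr1, addr0, add0r).
  rewrite /v !scalerDr !scalerA sj mu_mixC /mu_mix.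
  have b0 : beta != 0.
    by apply: contra_eq_neq b1 => ->; rewrite mul0r eq_sym oner_neq0.
  have -> : beta^* = beta^-1 by apply: (mulfI b0); rewrite b1 mulfV.
  move: (e i) (e j) => u u'; apply/matrixP => k l; rewrite !mxE.
  move: (u k l) (u' k l) => {}u {}u'.
  by case: (sgn i); rewrite /= ?expr0 ?expr1; field; rewrite b0.
(* Otherwise e_i is orthogonal to J conj v and S e_i = e_i + mu v, so x = 1 + mu and y = mu; their
   squared moduli 4/5 and 1/5 show that both are nonzero. *)
have mu2 : mu_mix * mu_mix^* = 1 / 5.
  rewrite mu_mixC /mu_mix.
  have -> : (-1 + 2 * 'i) / 5 * ((-1 - 2 * 'i) / 5)
    = (1 - 4 * ('i * 'i)) / 25 :> C by field.
  by rewrite ii; field.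
have mu1 : (1 + mu_mix) * (1 + mu_mix^*) = 4 / 5.
  transitivity (1 + (mu_mix + mu_mix^* + mu_mix * mu_mix^* * 2%:R)
    - mu_mix * mu_mix^*); first by ring.
  by rewrite mu_mix_norm mu2; field.
exists (1 + mu_mix), mu_mix; split.
- apply: contra_eq_neq mu1 => ->; rewrite mul0r eq_sym.
  by rewrite mulf_neq0 ?invr_eq0 ?pnatr_eq0.
- apply: contra_eq_neq mu2 => ->; rewrite mul0r eq_sym.
  by rewrite mulf_neq0 ?invr_eq0 ?pnatr_eq0 ?oner_eq0.
move=> beta b1; exists (symplectic_reflection J mu_mix (v beta)).
split; [exact: symS| |by move=> l; apply: fixS].
rewrite symplectic_reflectionE dot_v dot_w.
have mji : (mate j == i) = false.
  by apply/negbTE; apply: contra_neq jmi => <-; rewrite mateK.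
rewrite mji eqxx [j == i]eq_sym (negPf ij) (negPf (mate_neq i)).
rewrite !(mulr0, mulr1, addr0) scale0r addr0 /v scalerDr scalerA addrA.
by rewrite -[X in X + _ + _]scale1r -scalerDl [beta * _]mulrC.
Qed.

(** The reflection along the unit vector e_k with mu = 'i - 1, so that 1 + mu = 'i; the eigenvalue
    on the mate is the conjugate. *)
Lemma symplectic_torus k : exists S, [/\ symp S, S *m e k = 'i *: e k,
  S *m e (mate k) = (- 'i) *: e (mate k) &
  forall l, l != k -> l != mate k -> S *m e l = e l].
Proof.
pose S := symplectic_reflection J ('i - 1) (e k).
have muC : ('i - 1)^* = - 'i - 1 :> C by rewrite rmorphB /= conjCi rmorph1.
have SE x : S *m x = x + (('i - 1) * ((e k)^t* *m x) 0 0) *: e k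
    + ((- 'i - 1) * ((e (mate k))^t* *m x) 0 0) *: e (mate k).
  rewrite /S symplectic_reflectionE conj_delta J_e muC adjZ -!scalemxAl.
  have scE (a : C) (P : 'M[C]_1) : (a *: P) 0 0 = a * P 0 0 by rewrite mxE.
  rewrite scE scalerA rmorph_sign; congr (_ + _ *: _).
  have := sqrr_sign C (sgn k); rewrite expr2.
  move: (((e (mate k))^t* *m x) 0 0) ((-1) ^+ sgn k) => t s ss.
  transitivity ((- 'i - 1) * t * (s * s)); first by ring.
  by rewrite ss mulr1.
exists S; split.
- apply: (@symplectic_reflectionP _ _ _ _ _ _ _ _ 1) => //.
    by rewrite [LHS]mx11_scalar delta_dot eqxx.
  rewrite muC.
  transitivity (- 1 - 'i * 'i : C); first by ring.
  by rewrite ii opprK addrC subrr.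
- rewrite SE !delta_dot eqxx (negPf (mate_neq k)) mulr0 scale0r addr0 mulr1.
  by rewrite -{1}[e k]scale1r -scalerDl addrC subrK.
- rewrite SE !delta_dot eqxx eq_sym (negPf (mate_neq k)) mulr0 scale0r addr0.
  by rewrite mulr1 -{1}[e (mate k)]scale1r -scalerDl addrC subrK.
move=> l lk lmk; rewrite SE !delta_dot ![_ == l]eq_sym.
by rewrite (negPf lk) (negPf lmk) !mulr0 !scale0r !addr0.
Qed.

Lemma conj_mul_delta (S : 'M[C]_n) i j :
  S *m delta_mx i j *m S^t* = (S *m e i) *m (S *m e j)^t*.
Proof. by rewrite adj_mul !mulmxA -delta_mul_adj !mulmxA. Qed.

Lemma symplectic_conj_tr S : symp S -> S^T *m entry_conj S = 1%:M.
Proof.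
case=> /unitarymxP/mulmx1C SS _.
by rewrite -[S^T]map_mxCK -map_mxM SS map_mx1.
Qed.

Lemma conj_mul (S : 'M[C]_n) (x : 'cV[C]_n) :
  entry_conj S *m x = entry_conj (S *m entry_conj x).
Proof. by rewrite map_mxM map_mxCK. Qed.

Lemma adj_conj (S : 'M[C]_n) : (entry_conj S)^t* = S^T.
Proof. by rewrite -map_trmx map_mxCK. Qed.

Section CovariantMap.
Variable L : {linear 'M[C]_n -> 'M[C]_n}.
Hypothesis covL : cov L.

(** Scaling e_i by a phase gives S E_ii S^* = E_ii, so covariance becomes commutation with conj
    S. *)
Lemma covariant_commute S i t : symp S -> S *m e i = t *: e i ->
  t * t^* = 1 ->
  L (delta_mx i i) *m entry_conj S = entry_conj S *m L (delta_mx i i).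
Proof.
move=> symS Se t1; have := covL (delta_mx i i) symS.
rewrite conj_mul_delta Se adjZ -scalemxAl -scalemxAr scalerA t1 scale1r.
rewrite delta_mul_adj adj_conj => {1}->.
by rewrite -mulmxA symplectic_conj_tr // mulmx1.
Qed.

Lemma col_entry (M : 'M[C]_n) (i j : 'I_n) : (M *m e j) i 0 = M i j.
Proof. by rewrite -colE mxE. Qed.

(** The element given by [symplectic_torus] is diagonal, and its eigenvalue at k differs from all
    others; a matrix commuting with its conjugate has no off-diagonal entry in row k. *)
Lemma covariant_diag i k l : k != l -> L (delta_mx i i) k l = 0.
Proof.
move=> kl; have [S [symS Sk Smk Sl]] := symplectic_torus k.
set M := L _.
have phase j : exists2 t, S *m e j = t *: e j & t * t^* = 1.
  have [->|jk] := eqVneq j k.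
    by exists 'i; rewrite // conjCi mulrN ii opprK.
  have [->|jmk] := eqVneq j (mate k).
    by exists (- 'i); rewrite // rmorphN /= conjCi opprK mulNr ii opprK.
  by exists 1; rewrite ?rmorph1 ?mulr1 // scale1r Sl.
have conjS j t : S *m e j = t *: e j -> entry_conj S *m e j = t^* *: e j.
  by move=> St; rewrite conj_mul conj_delta St map_mxZ conj_delta.
have [ti Sti ti1] := phase i.
have MS := covariant_commute symS Sti ti1; rewrite -/M in MS.
have rowS j : j != k -> entry_conj S k j = 0.
  move=> jk; rewrite -col_entry; have [t St _] := phase j.
  by rewrite (conjS _ _ St) !mxE eq_sym (negPf jk) mulr0.
have Skk : entry_conj S k k = - 'i.
  by rewrite -col_entry (conjS _ _ Sk) !mxE !eqxx conjCi mulr1.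
have [tl Stl _] := phase l.
have : (M *m entry_conj S *m e l) k 0 = (entry_conj S *m M *m e l) k 0.
  by rewrite MS.
rewrite -mulmxA (conjS _ _ Stl) -scalemxAr mxE !col_entry [RHS]mxE.
rewrite (bigD1 k) //= big1 ?addr0 => [|j jk]; last by rewrite rowS // mul0r.
rewrite Skk => /eqP; rewrite -subr_eq0 -mulrBl mulf_eq0 => /orP[|/eqP //].
have -> : tl = S l l by rewrite -col_entry Stl !mxE !eqxx mulr1.
have [lmk|lmk] := eqVneq l (mate k).
  rewrite -col_entry lmk Smk !mxE !eqxx mulr1 rmorphN /= conjCi !opprK.
  by rewrite -mulr2n mulrn_eq0 /= (negPf (neq0Ci C)).
rewrite -col_entry Sl ?mxE ?eqxx //=; last by rewrite eq_sym.
rewrite rmorph1 opprK addr_eq0 => /eqP i1.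
by have := ii; rewrite -[X in X * X]opprK -i1 mulrNN mulr1 => /eqP;
  rewrite -subr_eq0 opprK -mulr2n pnatr_eq0.
Qed.

(** A reflection mixing e_j and e_k fixes e_i, hence commutes, up to conjugation, with the diagonal
    matrix L(E_ii). Comparing the (k, j) entries equates the two diagonal entries, because y is
    nonzero. *)
Lemma covariant_diag_const i j k :
    j \notin [:: i; mate i] -> k \notin [:: i; mate i] ->
  L (delta_mx i i) j j = L (delta_mx i i) k k.
Proof.
rewrite !inE !negb_or => /andP[ji jmi] /andP[ki kmi].
have [->//|jk] := eqVneq j k.
have [x [y [x0 y0 /(_ 1)]]] := symplectic_mixing jk.
rewrite rmorph1 mulr1 => /(_ erefl) [S [symS Sj Sl]].
have mate_swap a b : (a == mate b) = (b == mate a).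
  by rewrite -(inj_eq (inv_inj mateK)) mateK eq_sym.
have Si : S *m e i = 1 *: e i.
  rewrite scale1r Sl // !inE !negb_or [i == j]eq_sym ji [i == k]eq_sym ki.
  by rewrite ![i == mate _]mate_swap jmi kmi.
have i1 : 1 * 1^* = 1 :> C by rewrite rmorph1 mulr1.
have MS := covariant_commute symS Si i1; move: MS; set M := L _ => MS.
have diagM a b : M a b = (a == b)%:R * M b b.
  by have [->|ab] := eqVneq a b; rewrite ?mul1r // covariant_diag // mul0r.
have SE : entry_conj S k j = y^*.
  rewrite mxE -col_entry Sj mul1r !mxE !eqxx (eq_sym k) (negPf jk).
  by rewrite mulr0 add0r mulr1.
have : (M *m entry_conj S) k j = (entry_conj S *m M) k j by rewrite MS.
rewrite [LHS]mxE [RHS]mxE (bigD1 k) //= big1 ?addr0 => [|b bk]; last first.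
  by rewrite diagM eq_sym (negPf bk) !mul0r.
rewrite (bigD1 j) //= [X in _ + X]big1 ?addr0 => [|b bk]; last first.
  by rewrite (diagM b j) (negPf bk) mul0r mulr0.
by rewrite SE [RHS]mulrC => /mulIf; rewrite conjC_eq0 => /(_ y0).
Qed.

(* L kills (S e_i)(S e_i)^*; the phases beta = 1, -1, 'i separate its terms. *)
Lemma covariant_vanish i j : L (delta_mx i i) = 0 -> i != j ->
  [/\ L (delta_mx j j) = 0, L (delta_mx i j) = 0 & L (delta_mx j i) = 0].
Proof.
move=> Li ij; have [x [y [x0 y0 mix]]] := symplectic_mixing ij.
have cx0 : x^* != 0 by rewrite conjC_eq0.
have cy0 : y^* != 0 by rewrite conjC_eq0.
pose P := (x * y^*) *: L (delta_mx i j).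
pose Q := (y * x^*) *: L (delta_mx j i).
pose T := (y * y^*) *: L (delta_mx j j).
have rel beta : beta * beta^* = 1 -> beta^* *: P + beta *: Q + T = 0.
  move=> b1; have [S [symS Si _]] := mix _ b1.
  have := covL (delta_mx i i) symS; rewrite Li mulmx0 mul0mx.
  rewrite conj_mul_delta Si adjD !adjZ mulmxDl !mulmxDr -!scalemxAl -!scalemxAr.
  rewrite !delta_mul_adj !linearD !linearZ /= Li !scaler0 add0r !scalerA => <-.
  rewrite /T addrA rmorphM; congr (_ *: _ + _ *: _ + _ *: _).
  - ring.
  - ring.
  - by rewrite mulrACA b1 mul1r.
have r1 : P + Q + T = 0.
  by have := rel 1; rewrite rmorph1 mulr1 !scale1r; apply.
have r2 : - P - Q + T = 0.
  by have := rel (-1); rewrite rmorphN1 mulrNN mulr1 !scaleN1r; apply.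
have r3 : (- 'i) *: P + 'i *: Q + T = 0.
  by have := rel 'i; rewrite conjCi mulrN ii opprK; apply.
have two0 : 2 != 0 :> C by rewrite pnatr_eq0.
(* The relations for 1 and -1 add up to 2 T = 0; then the relation for 'i plus 'i times the one for
   1 gives 2 'i Q = 0. *)
have T0 : T = 0.
  apply: (scalerI two0); rewrite scaler0 -[RHS]addr0 -{1}r1 -r2.
  by apply/matrixP => a b; rewrite !mxE; ring.
have Q0 : Q = 0.
  apply: (scalerI (mulf_neq0 two0 (neq0Ci C))).
  rewrite scaler0 -[RHS]addr0 -{1}r3 -[in RHS](scaler0 _ 'i) -r1 T0.
  by apply/matrixP => a b; rewrite !mxE; ring.
have P0 : P = 0 by move: r1; rewrite T0 Q0 !addr0.
have scale0 c (M : 'M[C]_n) : c != 0 -> c *: M = 0 -> M = 0.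
  by move=> c0 /eqP; rewrite scaler_eq0 (negPf c0) => /eqP.
split.
- by apply: scale0 T0; rewrite mulf_neq0.
- by apply: scale0 P0; rewrite mulf_neq0.
- by apply: scale0 Q0; rewrite mulf_neq0.
Qed.

Lemma covariant_eq0 i0 :
  L (delta_mx i0 i0) = 0 -> forall Z, L Z = 0.
Proof.
move=> L0 Z.
have Ld j : L (delta_mx j j) = 0.
  by have [<-//|ij] := eqVneq i0 j; case: (covariant_vanish L0 ij).
rewrite (matrix_sum_delta Z) linear_sum big1 // => i _.
rewrite linear_sum big1 // => j _; rewrite linearZ /=.
have [->|ij] := eqVneq i j; first by rewrite Ld scaler0.
by have [_ -> _] := covariant_vanish (Ld i) ij; rewrite scaler0.
Qed.

End CovariantMap.

(** L(E_ii) is diagonal with one value at i, one at mate i and a common value elsewhere, while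
    [Psi J a p q] sends E_ii to a 1 + p E_ii + q J E_ii J^*, where the last matrix is the diagonal
    unit of mate i. Matching the three values makes the covariant difference vanish at E_ii, hence
    everywhere. *)
Theorem covariant_classification (L : {linear 'M[C]_n -> 'M[C]_n}) i j
    (M := L (delta_mx i i)) :
    cov L -> j \notin [:: i; mate i] ->
  forall Z, L Z = Psi J (M j j) (M i i - M j j)
                        (M (mate i) (mate i) - M j j) Z.
Proof.
move=> covL jP; set P := Psi J _ _ _.
have covP : cov P by exact: Psi_covariant.
pose D : {linear 'M[C]_n -> 'M[C]_n} := L \- P.
have DE Y : D Y = L Y - P Y by [].
have covD : cov D.
  by move=> S Z symS; rewrite !DE covL // covP // mulmxBr mulmxBl.
suff D0 : D (delta_mx i i) = 0.
  move=> Z; apply/eqP; rewrite -subr_eq0 -[_ - _]DE.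
  exact/eqP/(covariant_eq0 covD D0).
apply/eqP; rewrite DE subr_eq0; apply/eqP; rewrite -/M /P /Psi.
have -> : J *m delta_mx i i *m J^t* = delta_mx (mate i) (mate i).
  rewrite conj_mul_delta J_e adjZ -scalemxAl -scalemxAr scalerA rmorph_sign.
  by rewrite -expr2 sqrr_sign scale1r delta_mul_adj.
have -> : \tr (delta_mx i i : 'M[C]_n) = 1.
  by rewrite -delta_mul_adj mxtrace_mulC trace_mx11 delta_dot eqxx.
rewrite trmx_delta mulr1.
apply/matrixP => k l; rewrite !mxE.
have [<-|kl] := eqVneq k l; last first.
  have off a : (k == a) && (l == a) = false.
    by apply: contraNF kl => /andP[/eqP-> /eqP->].
  by rewrite !off !mulr0 !addr0 [LHS](covariant_diag covL).
rewrite !andbb mulr1.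
have [->|ki] := eqVneq k i.
  by rewrite eq_sym (negPf (mate_neq i)) mulr1 mulr0 addr0 addrC subrK.
have [->|kmi] := eqVneq k (mate i).
  by rewrite mulr1 mulr0 addr0 addrC subrK.
rewrite !mulr0 !addr0; apply: covariant_diag_const => //.
by rewrite !inE negb_or ki kmi.
Qed.

End Classification.

(** * The matrix Omega *)

Section OmegaFacts.
Variables (R : realType) (m : nat).
Local Notation C := R[i].
Local Notation J := (Omega (m + m) : 'M[C]_(m + m)).

Lemma Omega_real : entry_conj J = J.
Proof.
by rewrite Omega_block map_block_mx map_mxN map_mx1 !map_mx0.
Qed.

Lemma Omega_antisym : J^T = - J.
Proof.
rewrite Omega_block tr_block_mx linearN /= !trmx1 !trmx0 opp_block_mx.
by rewrite !oppr0 opprK.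
Qed.

Lemma Omega_orth : J *m J^t* = 1%:M.
Proof.
rewrite Omega_antisym map_mxN Omega_real mulmxN Omega_block mulmx_block.
rewrite !mul0mx !mulmx0 !mul1mx !mulmx1 !addr0 !add0r opp_block_mx !oppr0 opprK.
by rewrite -scalar_mx_block.
Qed.

Definition mate (i : 'I_(m + m)) : 'I_(m + m) :=
  match split i with inl a => rshift m a | inr a => lshift m a end.

Definition upper (i : 'I_(m + m)) : bool :=
  if split i is inl _ then true else false.

Lemma mate_lshift a : mate (lshift m a) = rshift m a.
Proof. by rewrite /mate (unsplitK (inl a)). Qed.

Lemma mate_rshift a : mate (rshift m a) = lshift m a.
Proof. by rewrite /mate (unsplitK (inr a)). Qed.

Lemma mate_involutive : involutive mate.
Proof.
by move=> i; case: (split_ordP i) => a ->; rewrite !(mate_lshift, mate_rshift).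
Qed.

Lemma upper_mate i : upper (mate i) = ~~ upper i.
Proof.
by case: (split_ordP i) => a ->; rewrite !(mate_lshift, mate_rshift) /upper
  (unsplitK (inl a)) (unsplitK (inr a)).
Qed.

Lemma Omega_delta i : J *m (delta_mx i 0 : 'cV[C]_(m + m))
  = (-1) ^+ upper i *: (delta_mx (mate i) 0 : 'cV[C]_(m + m)).
Proof.
apply/matrixP => k z; rewrite -colE [LHS]mxE (ord1 z) Omega_block /upper.
case: (split_ordP i) => a ->; case: (split_ordP k) => b ->;
  rewrite ?(mate_lshift, mate_rshift) ?(unsplitK (inl a)) ?(unsplitK (inr a))
    ?(block_mxEul, block_mxEur, block_mxEdl, block_mxEdr) !mxE
    ?(eq_lrshift, eq_rlshift, eq_lshift, eq_rshift) /= ?expr0 ?expr1 ?mul1r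
    ?mulN1r ?mulr0 ?andbT ?oppr0 //.
Qed.

Lemma Omega_isotropic a b : J (lshift m a) (lshift m b) = 0.
Proof. by rewrite Omega_block block_mxEul mxE. Qed.

End OmegaFacts.

(** * Decomposability *)

Section Positivity.
Variable R : realType.
Local Notation C := R[i].

Lemma completely_positiveP d (L : {linear 'M[C]_d -> 'M[C]_d}) :
  completely_positive L <->
  forall k (x w : 'I_k -> 'cV[C]_d), 0 <= tens_form L x w.
Proof. by split=> posL k; apply/k_positiveP/posL. Qed.

Lemma eq_completely_positive d (L L' : {linear 'M[C]_d -> 'M[C]_d}) :
  L =1 L' -> completely_positive L -> completely_positive L'.
Proof.
move=> eqL /completely_positiveP posL; apply/completely_positiveP => k x w.
by rewrite -(eq_tens_form _ _ eqL).
Qed.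

Lemma decomposable_trmx d (L : {linear 'M[C]_d -> 'M[C]_d}) :
  decomposable L -> decomposable (trmx \o L).
Proof.
move=> [L1 [L2 [cp1 cp2 defL]]]; exists (trmx \o L2), (trmx \o L1).
split; first exact: cp2.
  by apply: eq_completely_positive cp1 => Z; rewrite /= trmxK.
by move=> Z; rewrite /= defL linearD addrC.
Qed.

Lemma eq_decomposable d (L L' : {linear 'M[C]_d -> 'M[C]_d}) :
  L =1 L' -> decomposable L -> decomposable L'.
Proof.
move=> eqL [L1 [L2 [cp1 cp2 defL]]]; exists L1, L2; split=> // Z.
by rewrite -eqL.
Qed.

Lemma k_positive_diag k d (L : {linear 'M[C]_d -> 'M[C]_d}) i j :
  k_positive k.+1 L -> 0 <= L (delta_mx i i) j j.
Proof.
by move=> /k_positiveP posL; rewrite -(tens_form_diag k).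
Qed.

End Positivity.

(** * The maps L^T_(p,q), the indecomposable example and d/2-positive covariant maps *)

Section Main.
Variables (R : realType) (m : nat).
Local Notation C := R[i].
Local Notation J := (Omega (m + m) : 'M[C]_(m + m)).
Local Notation d := (m + m)%N.

Lemma J_conj_linear (L : {linear 'M[C]_d -> 'M[C]_d}) :
  {L' : {linear 'M[C]_d -> 'M[C]_d} | L' =1 J_conj J L}.
Proof.
by exists (mulmxr J \o (mulmx (J^t*) \o L)).
Qed.

Lemma decomposable_J_conj (L L' : {linear 'M[C]_d -> 'M[C]_d}) :
  L' =1 J_conj J L -> decomposable L -> decomposable L'.
Proof.
move=> defL' [L1 [L2 [cp1 cp2 defL]]].
have [L1' L1E] := J_conj_linear L1; have [L2' L2E] := J_conj_linear L2.
exists L1', L2'; split.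
- apply/completely_positiveP => k x w; rewrite (eq_tens_form _ _ L1E).
  by rewrite tens_form_J_conj; move/completely_positiveP: cp1; apply.
- apply/completely_positiveP => k x w.
  (* As J is real, transposing the output commutes with [J_conj], so the co-CP part stays co-CP. *)
  have E : trmx \o L2' =1 J_conj J (trmx \o L2).
    move=> Z; rewrite /J_conj /= L2E /J_conj !trmx_mul map_trmx trmxK.
    rewrite Omega_real.
    by rewrite mulmxA Omega_antisym map_mxN Omega_real.
  rewrite (eq_tens_form _ _ E) tens_form_J_conj.
  by move/completely_positiveP: cp2; apply.
by move=> Z; rewrite defL' L1E L2E /J_conj defL mulmxDr mulmxDl.
Qed.

Lemma LpqTE (p q : R) (Z : 'M[C]_d) :
  LpqT d p q Z
  = ((1 - p - q)%:C%C * (\tr Z / d%:R)) *: 1%:M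
    + p%:C%C *: Z^T
    + q%:C%C *: (J *m Z *m J^t*).
Proof.
rewrite /LpqT /= /Lpq !linearD !linearZ /= trmx1; congr (_ + _ *: _).
by rewrite !trmx_mul trmxK map_trmx trmxK Omega_real mulmxA Omega_antisym
  map_mxN Omega_real.
Qed.

Lemma LpqT_Psi (p q : R) :
  LpqT d p q =1 Psi J ((1 - p - q)%:C%C / d%:R) p%:C%C q%:C%C.
Proof. by move=> Z; rewrite LpqTE /Psi mulrAC mulrA. Qed.

Lemma Lpq_J_conj (p q : R) : Lpq (d := d) q p =1 J_conj J (LpqT d p q).
Proof.
move=> Z; rewrite /J_conj LpqT_Psi -/(J_conj J (Psi _ _ _ _) Z).
rewrite (J_conj_Psi (Omega_orth R m)) /Lpq addrAC mulrAC mulrA.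
rewrite [1 - q - p]addrAC.
by rewrite Omega_antisym map_mxN Omega_real mulmxN !mulNmx.
Qed.

Lemma LpqT_k_positive k (p q : R) :
  k_positive k (LpqT d p q) <-> kpos_set k d (q, p).
Proof.
have formE (x w : 'I_k -> 'cV[C]_d) :
    tens_form (Lpq (d := d) q p) x w = tens_form (J_conj J (LpqT d p q)) x w.
  exact/eq_tens_form/Lpq_J_conj.
split=> /k_positiveP posL; apply/k_positiveP => /= x w.
  by rewrite formE tens_form_J_conj.
apply: (J_conj_forms (Omega_orth R m) k (LpqT d p q)).1 x w => x w.
by rewrite -formE.
Qed.

Lemma LpqT_decomposable (p q : R) :
  decomposable (LpqT d p q) <-> decomp_set d (q, p).
Proof.
split; first exact/decomposable_J_conj/Lpq_J_conj.
(* [J_conj] is an involution, so applying it once more leads back. *)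
apply: decomposable_J_conj => Z.
transitivity (J_conj J (J_conj J (LpqT d p q)) Z).
  rewrite /J_conj; symmetry; apply: J_conjK (Omega_orth R m) _.
  - exact: Omega_real.
  - exact: Omega_antisym.
by rewrite {1}/J_conj -Lpq_J_conj.
Qed.

Lemma LpqT_decomposable_sym (p q : R) :
  decomposable (LpqT d p q) <-> decomp_set d (p, q).
Proof.
split; last exact: decomposable_trmx.
by move/decomposable_trmx; apply: eq_decomposable => Z; rewrite /= trmxK.
Qed.

Lemma Psi_conj_covariant (a p q : C) : conj_covariant (Psi J a p q).
Proof.
by move=> S Z symS; apply: Psi_covariant.
Qed.

Lemma decomposable_witness (L : {linear 'M[C]_d -> 'M[C]_d}) :
  decomposable L -> 0 <= witness J L.
Proof.
move=> [L1 [L2 [/completely_positiveP pos1 /completely_positiveP pos2 defL]]].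
exact: (witness_decomposable_ge0 (Omega_real R m) (Omega_antisym R m)
  (Omega_orth R m) pos1 pos2 defL).
Qed.

Lemma Psi_k_positive k : (0 < k)%N -> k_positive k (Psi J 1 (-1) (- k%:R^-1)).
Proof.
move=> k0; apply/k_positiveP => x w.
(* With c = 1/k and r = 2 k the condition c r <= 2 holds with equality. *)
apply: (Psi_pos (Omega_antisym R m) (Omega_orth R m) (r := k.*2)).
- exact: geq_minl.
- by rewrite invr_ge0 ler0n.
- by rewrite -muln2 natrM mulrA mulVf ?mul1r // pnatr_eq0 -lt0n.
Qed.

(** With d = 2 m and k = m - 1 the witness takes the value 4 m^2 + 4 m - (1 + 1/k) 4 m^2 = - 4 m /
    k, which is negative. *)
Lemma Psi_indecomposable : (1 < m)%N ->
  indecomposable (Psi J 1 (-1) (- m.-1%:R^-1)).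
Proof.
move=> m1 /decomposable_witness.
rewrite (witness_Psi (Omega_real R m) (Omega_antisym R m) (Omega_orth R m)).
have k0 : m.-1%:R != 0 :> C by rewrite pnatr_eq0; case: m m1 => [|[]].
have mE : m%:R = m.-1%:R + 1 :> C by rewrite natr1 prednK // ltnW.
rewrite natrD mE.
suff -> : 1 * ((m.-1%:R + 1 + (m.-1%:R + 1)) ^+ 2
      + (m.-1%:R + 1 + (m.-1%:R + 1)) *+ 2)
    + (-1 - m.-1%:R^-1) * (m.-1%:R + 1 + (m.-1%:R + 1)) ^+ 2
    = - (4 * (m.-1%:R + 1) / m.-1%:R) :> C.
  rewrite oppr_ge0 lt_geF // mulr_gt0 ?invr_gt0 ?mulr_gt0 ?ltr0n //.
    by rewrite natr1 ltr0n.
  by case: m m1 => [|[]].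
by field.
Qed.

Lemma Psi_decomposable (a p q : C) : (0 < m)%N -> 0 <= a -> 0 <= p + a ->
  0 <= a + q * m%:R -> decomposable (Psi J a p q).
Proof.
move=> m0 a0 pa0 qa0; exists (Psi J a (- a) q), (Psi J 0 (p + a) 0); split.
- apply/completely_positiveP => k x w.
  have m0' : m%:R != 0 :> C by rewrite pnatr_eq0 -lt0n.
  (* The choice c = 1/m gives c d = 2, and q + a c >= 0 is the hypothesis a + q m >= 0 divided by
     m. *)
  apply: (Psi_forms_ge0 (Omega_antisym R m) (Omega_orth R m)
    (c := m%:R^-1)) => //.
  - by rewrite invr_ge0 ler0n.
  - by rewrite natrD mulrDr mulVf.
  - by rewrite -(pmulr_lge0 _ (_ : 0 < m%:R)) ?ltr0n // mulrDl mulfVK // addrC.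
- apply/completely_positiveP => k x w.
  rewrite (@eq_tens_form _ _ _ _ (fun Z => (p + a) *: Z)); last first.
    by move=> Z; rewrite /= trmx_Psi_transpose.
  exact: (scale_forms (Omega_orth R m)).
exact: Psi_split.
Qed.

Lemma covariant_decomposable (L : {linear 'M[C]_d -> 'M[C]_d}) : (1 < m)%N ->
  conj_covariant L -> k_positive m L -> decomposable L.
Proof.
move=> m1 covL posL.
(* Two distinct indices of the first half, available as m > 1, are never mates. *)
pose i : 'I_d := lshift m (Ordinal (ltnW m1)).
pose j : 'I_d := lshift m (Ordinal m1).
have ji : j \notin [:: i; mate i].
  by rewrite !inE /i /j mate_lshift eq_lshift eq_lrshift.
have covL' : covariant J L by move=> S Z symS; apply: covL.
pose M := L (delta_mx i i).
have diag l : 0 <= M l l.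
  by apply: (@k_positive_diag R m.-1); rewrite prednK // ltnW.
have [a [p [q [LE [a0 pa0 _]]]]] : exists a p q, (forall Z, L Z = Psi J a p q Z)
    /\ [/\ 0 <= a, 0 <= p + a & 0 <= q + a].
  exists (M j j), (M i i - M j j), (M (mate i) (mate i) - M j j).
  rewrite !subrK; split; last by split; apply: diag.
  exact: (covariant_classification (Omega_real R m) (Omega_antisym R m)
    (Omega_orth R m) (@mate_involutive m) (@upper_mate m) (@Omega_delta R m)
    covL' ji).
apply: (@eq_decomposable _ _ (Psi J a p q)); first exact: fsym LE.
apply: Psi_decomposable => //; first exact: ltnW.
(* The remaining condition a + q m >= 0 comes from the isotropic span of the first m basis vectors,
   whose dimension is the level of positivity. *)
have /k_positiveP := posL.
pose x (s : 'I_m) : 'cV[C]_d := delta_mx (lshift m s) 0.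
have formE : tens_form (Psi J a p q) x (fun s => J *m x s)
    = m%:R * (a + q * m%:R).
  exact: (Psi_isotropic_form (Omega_real R m) (Omega_antisym R m)
    (Omega_orth R m) a p q (@lshift_inj m m) (@Omega_isotropic R m)).
have m0 : 0 < m%:R :> C by rewrite ltr0n ltnW.
move=> /(_ x (fun s => J *m x s)).
by rewrite (eq_tens_form _ _ LE) formE (pmulr_rge0 _ m0).
Qed.

End Main.

Local Open Scope complex_scope.

Theorem theorem3p10 (R : realType) (d : nat) (d_ge4 : (4 <= d)%N)
    (d_even : ~~ odd d) :
  (forall (p q : R) (Z : 'M[R[i]]_d),
      LpqT d p q Z
      = ((1 - p - q)%:C * (\tr Z / d%:R)) *: 1%:M
        + p%:C *: Z^T
        + q%:C *: (Omega d *m Z *m (Omega d)^t*))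
  /\ (forall (p q : R) (k : nat), (1 <= k <= d)%N ->
      k_positive k (LpqT d p q) <-> kpos_set k d (q, p))
  /\ (forall p q : R,
      (decomposable (LpqT d p q) <-> decomp_set d (q, p))
      /\ (decomposable (LpqT d p q) <-> decomp_set d (p, q)))
  /\ (exists L : {linear 'M[R[i]]_d -> 'M[R[i]]_d},
      [/\ conj_covariant L, k_positive d./2.-1 L & indecomposable L])
  /\ (forall L : {linear 'M[R[i]]_d -> 'M[R[i]]_d},
      conj_covariant L -> k_positive d./2 L -> decomposable L).
Proof.
have [m def_d] : exists m, d = (m + m)%N.
  by exists d./2; rewrite addnn even_halfK.
subst d; have m1 : (1 < m)%N by move: d_ge4; rewrite addnn (leq_double 2).
have -> : (m + m)./2 = m by rewrite addnn doubleK.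
split; first exact: LpqTE.
split; first by move=> p q k _; apply: LpqT_k_positive.
split.
  move=> p q; split; first exact: LpqT_decomposable.
  exact: LpqT_decomposable_sym.
split; last by move=> L; apply: covariant_decomposable.
exists (Psi (Omega (m + m)) 1 (-1) (- m.-1%:R^-1)); split.
- exact: Psi_conj_covariant.
(* The level m - 1 is nonzero since m > 1, so its inverse is not the default value 0. *)
- by apply: Psi_k_positive; case: m m1 {d_ge4 d_even} => [|[]].
- exact: Psi_indecomposable.
Qed.
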